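(* Let $(\mathcal{L},\circ_\lambda,\ast_\lambda)$ be a pre-Lie commutative conformal algebra such that $$(a\circ_\lambda b)\ast_{\lambda+\mu}c=a\circ_\lambda(b\ast_\mu c)\qquad\text{for all }a,b,c\in\mathcal{L}.$$ Then $(\mathcal{L},\circ_\lambda,[\cdot_\lambda\cdot])$ is a transposed Poisson conformal algebra, where $[a_\lambda b]=a\ast_\lambda b-b\ast_{-\partial-\lambda}a$ for all $a,b\in\mathcal{L}$. In particular, the conclusion holds when $(\mathcal{L},\circ_\lambda,\ast_\lambda)$ is a differential Novikov-Poisson conformal algebra.
   Context: All vector spaces, linear maps and tensor products are over $\mathbb{C}$. For a vector space $A$, $A[\lambda]$ denotes polynomials in $\lambda$ with coefficients in $A$. A conformal algebra $(A,\circ_\lambda)$ is a $\mathbb{C}[\partial]$-module $A$ with a $\mathbb{C}$-bilinear map $A\otimes A\to A[\lambda]$, $a\otimes b\mapsto a\circ_\lambda b$, such that $(\partial a)\circ_\lambda b=-\lambda\, a\circ_\lambda b$ and $a\circ_\lambda(\partial b)=(\partial+\lambda)(a\circ_\lambda b)$. Convention: products are extended linearly to polynomials in formal variables. If $a\circ_\lambda b=\sum_n\lambda^n w_n$ and $\nu$ is a linear combination of formal variables, then $a\circ_{-\partial+\nu}b=\sum_n(-\partial+\nu)^n w_n$, where $\partial$ acts on the coefficients $w_n$ of the product carrying that subscript; the same convention applies to $\ast_\lambda$ and $[\cdot_\lambda\cdot]$. A commutative associative conformal algebra is a conformal algebra with $a\circ_\lambda(b\circ_\mu c)=(a\circ_\lambda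 b)\circ_{\lambda+\mu}c$ and $a\circ_\lambda b=b\circ_{-\partial-\lambda}a$ for all $a,b,c$. A Lie conformal algebra $(A,[\cdot_\lambda\cdot])$ is a conformal algebra (with product written $[a_\lambda b]$) such that $[a_\lambda b]=-[b_{-\lambda-\partial}a]$ and $[a_\lambda[b_\mu c]]=[[a_\lambda b]_{\lambda+\mu}c]+[b_\mu[a_\lambda c]]$ for all $a,b,c$. A left-symmetric conformal algebra $(A,\ast_\lambda)$ is a conformal algebra with $(a\ast_\lambda b)\ast_{\lambda+\mu}c-a\ast_\lambda(b\ast_\mu c)=(b\ast_\mu a)\ast_{\lambda+\mu}c-b\ast_\mu(a\ast_\lambda c)$ for all $a,b,c$. A Novikov conformal algebra is a left-symmetric conformal algebra with $(a\ast_\lambda b)\ast_{\lambda+\mu}c=(a\ast_\lambda c)\ast_{-\mu-\partial}b$ for all $a,b,c$. A pre-Lie commutative conformal algebra $(\mathcal{L},\circ_\lambda,\ast_\lambda)$ is a $\mathbb{C}[\partial]$-module $\mathcal{L}$ such that $(\mathcal{L},\circ_\lambda)$ is a commutative associative conformal algebra, $(\mathcal{L},\ast_\lambda)$ is a left-symmetric conformal algebra, and $a\ast_\lambda(b\circ_\mu c)=(a\ast_\lambda b)\circ_{\lambda+\mu}c+b\circ_\mu(a\ast_\lambda c)$ for all $a,b,c\in\mathcal{L}$. A differential Novikov-Poisson conformal algebra is a triple $(\mathcal{N},\circ_\lambda,\ast_\lambda)$ where $(\mathcal{N},\circ_\lambda)$ is a commutative associative conformal algebra, $(\mathcal{N},\ast_\lambda)$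 is a Novikov conformal algebra, and for all $a,b,c\in\mathcal{N}$: $(a\circ_\lambda b)\ast_{\lambda+\mu}c=a\circ_\lambda(b\ast_\mu c)$; $(a\ast_\lambda b)\circ_{\lambda+\mu}c-a\ast_\lambda(b\circ_\mu c)=(b\ast_\mu a)\circ_{\lambda+\mu}c-b\ast_\mu(a\circ_\lambda c)$; and $a\ast_\lambda(b\circ_\mu c)=(a\ast_\lambda b)\circ_{\lambda+\mu}c+b\circ_\mu(a\ast_\lambda c)$. A transposed Poisson conformal algebra (TPCA) is a $\mathbb{C}[\partial]$-module $\mathcal{L}$ with $\mathbb{C}$-bilinear maps $\circ_\lambda,[\cdot_\lambda\cdot]:\mathcal{L}\otimes\mathcal{L}\to\mathcal{L}[\lambda]$ such that $(\mathcal{L},\circ_\lambda)$ is a commutative associative conformal algebra, $(\mathcal{L},[\cdot_\lambda\cdot])$ is a Lie conformal algebra, and $2(a\circ_\lambda[b_\mu c])=[(a\circ_\lambda b)_{\lambda+\mu}c]+[b_\mu(a\circ_\lambda c)]$ for all $a,b,c\in\mathcal{L}$. *)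

(* Defs.v *)
From HB Require Import structures.
From mathcomp Require Import all_boot all_order all_algebra.
From mathcomp Require Import finmap.
From mathcomp Require Import complex reals monalg.

Set Implicit Arguments.
Unset Strict Implicit.
Unset Printing Implicit Defensive.

Import GRing.Theory.
Local Open Scope ring_scope.

(* The field of complex numbers is R[i] for R : realType, and a C[d]-module is
   a module over {poly R[i]}: d acts by 'X *: _ and a scalar c by c%:P *: _.
   Since A is not a ring, {poly A} is not available for A[lambda]; we use the
   finitely supported functions from commutative monomials to A instead.
   The variables of formal A n are indexed by 'I_n. *)
Notation formal A n := {malg A[{cmonom 'I_n}]}.

Section Formal.
Variables (R : realType) (A : lmodType {poly R[i]}).

Section Operators.
Variable n : nat.

Definition mulmonom (m : {cmonom 'I_n}) (p : formal A n) : formal A n :=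
  \sum_(k <- msupp p) << p@_k *g (mmul m k) >>.

Definition mulX (i : 'I_n) : formal A n -> formal A n := mulmonom (ucm i).

Definition actc (u : {poly R[i]}) (p : formal A n) : formal A n :=
  \sum_(m <- msupp p) << u *: p@_m *g m >>.

(* A linear combination nu of d and of the formal variables is represented by
   the operator it induces on formal A n; if w = \sum_k lambda^k w_k, then
   subst nu w = \sum_k nu^k w_k, where d acts on the coefficients w_k. *)
Definition subst (nu : formal A n -> formal A n) (w : formal A 1) :
    formal A n :=
  \sum_(m <- msupp w) iter (m ord0) nu (malgC w@_m).

(* The product p f_nu q, extended linearly to polynomials in the variables:
   (x^m a) f_nu (x^m' b) = x^(m + m') (a f_nu b). Any d in nu acts only on the
   coefficients of a f_nu b. *)
Definition fprod (f : A -> A -> formal A 1) (nu : formal A n -> formal A n)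
    (p q : formal A n) : formal A n :=
  \sum_(m <- msupp p) \sum_(m' <- msupp q)
    mulmonom (mmul m m') (subst nu (f p@_m q@_m')).

End Operators.

Definition partial n : formal A n -> formal A n := actc 'X.

End Formal.

Arguments mulX {R A n}.
Arguments partial {R A n}.

Notation "p *_[ f , nu ] q" := (fprod f nu p q)
  (at level 40, f at level 99, nu at level 99, q at next level,
   format "p  *_[ f ,  nu ]  q").

(* lambda is the first variable; mu is the second one, in formal A 2. *)
Notation lam := (mulX ord0).
Notation mu := (mulX (ord_max : 'I_2)).

Section Conformal.
Variables (R : realType) (A : lmodType {poly R[i]}).
Implicit Types (f g : A -> A -> formal A 1) (a b c : A).

Record conformal_algebra f : Prop := ConformalAlgebra {
  conformalDl : forall a b c, f (a + b) c = f a c + f b c;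
  conformalDr : forall a b c, f a (b + c) = f a b + f a c;
  conformalZl : forall (z : R[i]) a b, f (z%:P *: a) b = actc z%:P (f a b);
  conformalZr : forall (z : R[i]) a b, f a (z%:P *: b) = actc z%:P (f a b);
  conformal_partiall : forall a b, f ('X *: a) b = - lam (f a b);
  conformal_partialr : forall a b,
    f a ('X *: b) = partial (f a b) + lam (f a b)
}.

Record comm_assoc_conformal f : Prop := CommAssocConformal {
  cac_conformal : conformal_algebra f;
  cac_assoc : forall a b c,
    a%:MP *_[f, lam] (b%:MP *_[f, mu] c%:MP)
    = (a%:MP *_[f, lam] b%:MP) *_[f, lam \+ mu] c%:MP :> formal A 2;
  cac_comm : forall a b,
    a%:MP *_[f, lam] b%:MP = b%:MP *_[f, \- partial \- lam] a%:MP :> formal A 1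
}.

Record lie_conformal f : Prop := LieConformal {
  lie_conformal_conformal : conformal_algebra f;
  lie_conformal_skew : forall a b,
    a%:MP *_[f, lam] b%:MP = - (b%:MP *_[f, \- lam \- partial] a%:MP)
    :> formal A 1;
  lie_conformal_jacobi : forall a b c,
    a%:MP *_[f, lam] (b%:MP *_[f, mu] c%:MP)
    = (a%:MP *_[f, lam] b%:MP) *_[f, lam \+ mu] c%:MP
      + b%:MP *_[f, mu] (a%:MP *_[f, lam] c%:MP) :> formal A 2
}.

Record left_symmetric_conformal g : Prop := LeftSymmetricConformal {
  lsc_conformal : conformal_algebra g;
  lsc_left_symmetric : forall a b c,
    (a%:MP *_[g, lam] b%:MP) *_[g, lam \+ mu] c%:MP
      - a%:MP *_[g, lam] (b%:MP *_[g, mu] c%:MP)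
    = (b%:MP *_[g, mu] a%:MP) *_[g, lam \+ mu] c%:MP
      - b%:MP *_[g, mu] (a%:MP *_[g, lam] c%:MP) :> formal A 2
}.

Record novikov_conformal g : Prop := NovikovConformal {
  novikov_left_symmetric : left_symmetric_conformal g;
  novikov_right_comm : forall a b c,
    (a%:MP *_[g, lam] b%:MP) *_[g, lam \+ mu] c%:MP
    = (a%:MP *_[g, lam] c%:MP) *_[g, \- mu \- partial] b%:MP :> formal A 2
}.

Definition conformal_leibniz f g : Prop := forall a b c,
  a%:MP *_[g, lam] (b%:MP *_[f, mu] c%:MP)
  = (a%:MP *_[g, lam] b%:MP) *_[f, lam \+ mu] c%:MP
    + b%:MP *_[f, mu] (a%:MP *_[g, lam] c%:MP) :> formal A 2.

Definition conformal_module_compat f g : Prop := forall a b c,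
  (a%:MP *_[f, lam] b%:MP) *_[g, lam \+ mu] c%:MP
  = a%:MP *_[f, lam] (b%:MP *_[g, mu] c%:MP) :> formal A 2.

Record prelie_comm_conformal f g : Prop := PreLieCommConformal {
  plc_comm_assoc : comm_assoc_conformal f;
  plc_left_symmetric : left_symmetric_conformal g;
  plc_leibniz : conformal_leibniz f g
}.

Record diff_novikov_poisson_conformal f g : Prop :=
    DiffNovikovPoissonConformal {
  dnp_comm_assoc : comm_assoc_conformal f;
  dnp_novikov : novikov_conformal g;
  dnp_compat : conformal_module_compat f g;
  dnp_left_symmetric : forall a b c,
    (a%:MP *_[g, lam] b%:MP) *_[f, lam \+ mu] c%:MP
      - a%:MP *_[g, lam] (b%:MP *_[f, mu] c%:MP)
    = (b%:MP *_[g, mu] a%:MP) *_[f, lam \+ mu] c%:MP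
      - b%:MP *_[g, mu] (a%:MP *_[f, lam] c%:MP) :> formal A 2;
  dnp_leibniz : conformal_leibniz f g
}.

Record transposed_poisson_conformal f g : Prop := TransposedPoissonConformal {
  tpc_comm_assoc : comm_assoc_conformal f;
  tpc_lie : lie_conformal g;
  tpc_compat : forall a b c,
    (a%:MP *_[f, lam] (b%:MP *_[g, mu] c%:MP)) *+ 2
    = (a%:MP *_[f, lam] b%:MP) *_[g, lam \+ mu] c%:MP
      + b%:MP *_[g, mu] (a%:MP *_[f, lam] c%:MP) :> formal A 2
}.

Definition conformal_commutator g a b : formal A 1 :=
  a%:MP *_[g, lam] b%:MP - b%:MP *_[g, \- partial \- lam] a%:MP.

End Conformal.

(* Main.v *)
Require Import Defs.
From mathcomp Require Import all_boot all_order all_algebra.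
From mathcomp Require Import finmap.
From mathcomp Require Import complex boolp reals monalg.

Set Implicit Arguments.
Unset Strict Implicit.
Unset Printing Implicit Defensive.

Import GRing.Theory.
Local Open Scope ring_scope.

(** Conformal identities behave like identities of ordinary algebras once each
    of the three arguments carries its own spectral variable, subject to
    nu1 + nu2 + nu3 = - partial on the product of the three. Call such a triple
    of pairs x = (nu1, a), y = (nu2, b), z = (nu3, c) balanced, and write x(yz)
    for a f_nu1 (b g_nu2 c) and (xy)z for (a f_nu1 b) g_(nu1 + nu2) c. Three
    facts make the dictionary work.

    - An identity known for the variables lambda and mu holds for every
      balanced triple, hence for all permutations of x, y, z: substitute nu1
      and nu2 for lambda and mu ([subst2]). In particular one may substitute
      for mu the combination - lambda - mu - partial.
    - The opposite product of g is b g_(-partial - lambda) a, as a function of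
      a and b. Replacing a product by its opposite exchanges its two arguments
      in the expressions above ([nest_right_oppositer], [nest_leftE] and their
      consequences): by sesquilinearity, partial acting on an inner product
      becomes partial + nu1 outside, and - partial - nu1 - nu2 is nu3.
    - Hence the bracket [a_lambda b], which is ast minus its opposite, expands
      as an ordinary commutator does.

    What is left is classical. The commutator of a left-symmetric product
    satisfies the Jacobi identity, as the sum of three left-symmetry relations
    ([nest_jacobi]). For the transposed Leibniz rule ([nest_transposed]), write
    juxtaposition for circ; then (xy) * z = x(y * z) and the Leibniz rule turn
    [xy, z] + [y, xz] into
      2 x(y * z) - 2 x(z * y) - (z * x)y + (y * x)z,
    and the last two terms cancel because, by commutativity of circ,
      (z * x)y = y(z * x) = (yz) * x = (zy) * x = z(y * x) = (y * x)z.
    A differential Novikov-Poisson conformal algebra satisfies all of these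
    hypotheses by definition. *)

(** * Additive maps and intertwining relations *)

(** Additivity is a proposition about bare functions because the operators that
    stand for the spectral variables are bare functions. *)
Definition morphD (U V : zmodType) (h : U -> V) := {morph h : x y / x + y}.

Section MorphD.
Variables (U V W : zmodType).
Implicit Types (h k : U -> V).

Lemma morphD_0 h : morphD h -> h 0 = 0.
Proof. by move=> hD; apply: (addrI (h 0)); rewrite -hD !addr0. Qed.

Lemma morphD_N h : morphD h -> {morph h : x / - x}.
Proof.
by move=> hD x; apply: (addrI (h x)); rewrite -hD !subrr (morphD_0 hD).
Qed.

Lemma morphD_B h : morphD h -> {morph h : x y / x - y}.
Proof. by move=> hD x y; rewrite hD (morphD_N hD). Qed.

Lemma morphD_comp h (k : V -> W) : morphD h -> morphD k -> morphD (k \o h).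
Proof. by move=> hD kD x y; rewrite /= hD kD. Qed.

Lemma morphD_add h k : morphD h -> morphD k -> morphD (h \+ k).
Proof. by move=> hD kD x y; rewrite /= hD kD addrACA. Qed.

Lemma morphD_opp h : morphD h -> morphD (\- h).
Proof. by move=> hD x y; rewrite /= hD opprD. Qed.

Lemma morphD_iter (h : U -> U) n : morphD h -> morphD (iter n h).
Proof. by move=> hD; elim: n => [|n IHn] x y //=; rewrite IHn hD. Qed.

End MorphD.

(** Sesquilinearity of a product says that it intertwines the action of partial
    or of a variable on an argument with another operator on the result.
    Relations of this form compose, so they compute the effect of a chain of
    products and substitutions without expanding any sum. *)
Definition intertwines (U V : Type) (h : U -> V) (nu : U -> U) (nu' : V -> V) :=
  forall x, h (nu x) = nu' (h x).

Lemma intertwines_comp (U V W : Type) (h : U -> V) (k : V -> W) nu1 nu2 nu3 :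
  intertwines h nu1 nu2 -> intertwines k nu2 nu3 ->
  intertwines (k \o h) nu1 nu3.
Proof. by move=> hP kP x; rewrite /= hP kP. Qed.

Section Intertwines.
Variables (U V : zmodType) (h : U -> V).
Hypothesis hD : morphD h.

Lemma intertwines_add nu1 nu2 nu1' nu2' :
  intertwines h nu1 nu1' -> intertwines h nu2 nu2' ->
  intertwines h (nu1 \+ nu2) (nu1' \+ nu2').
Proof. by move=> h1 h2 x; rewrite /= hD h1 h2. Qed.

Lemma intertwines_opp nu nu' :
  intertwines h nu nu' -> intertwines h (\- nu) (\- nu').
Proof. by move=> h1 x; rewrite /= (morphD_N hD) h1. Qed.

End Intertwines.

(** With l_i and r_i the six products (xy)z and x(yz), the hypotheses are three
    instances of left-symmetry and the conclusion is the Jacobi identity for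
    the commutator, already expanded. *)
Lemma jacobi_zmod (V : zmodType) (l1 l2 l3 l4 l5 l6 r1 r2 r3 r4 r5 r6 : V) :
  l1 - r1 = l2 - r2 -> l3 - r3 = l4 - r4 -> l5 - r5 = l6 - r6 ->
  r1 - l3 - (r6 - l4) = l1 - r5 - (l2 - r4) + (r2 - l6 - (r3 - l5)).
Proof.
have flat a b c d : a - b = c - d -> a - b - c + d = 0 :> V.
  by move=> e; rewrite -addrA -[d]opprK -opprD e subrr.
move=> /flat E1 /flat E2 /flat E3; apply/esym/subr0_eq.
rewrite !(opprD, opprK, addrA).
(* The flattened difference of the two sides has twelve terms, which split into
   the three vanishing sums E1, E2 and E3. *)
rewrite (ACl ((1*9*3*5)*(8*2*6*11)*(10*7*12*4)))/=.
by rewrite E1 E2 E3 !addr0.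
Qed.

(** * Polynomials with coefficients in a module *)

Section FiniteSupport.
Variables (K : choiceType) (G V : zmodType).
Implicit Types (F : K -> G -> V) (p q : {malg G[K]}).

Lemma msupp_sumEw F p (d : {fset K}) : (forall k, F k 0 = 0) ->
  (msupp p `<=` d)%fset ->
  \sum_(k <- msupp p) F k p@_k = \sum_(k <- d) F k p@_k.
Proof.
move=> F0 sub; apply: big_fset_incl => // k _ knp.
by rewrite mcoeff_outdom.
Qed.

Lemma msupp_sumD F : (forall k, morphD (F k)) ->
  morphD (fun p => \sum_(k <- msupp p) F k p@_k).
Proof.
move=> FD p q; have F0 k : F k 0 = 0 by exact: morphD_0.
set d := (msupp p `|` msupp q)%fset.
rewrite (msupp_sumEw F0 (msuppD_le p q)) -/d.
rewrite (@msupp_sumEw F p d F0 (fsubsetUl _ _)).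
rewrite (@msupp_sumEw F q d F0 (fsubsetUr _ _)) -big_split /=.
by apply: eq_bigr => k _; rewrite mcoeffD FD.
Qed.

Lemma msupp_sumU F a k : (forall k, F k 0 = 0) ->
  \sum_(j <- msupp << a *g k >>) F j << a *g k >>@_j = F k a.
Proof.
move=> F0; rewrite (msupp_sumEw F0 msuppU_le) big_seq_fset1.
by rewrite mcoeffUU.
Qed.

Lemma morphD_malg_ext (h k : {malg G[K]} -> V) : morphD h -> morphD k ->
  (forall a m, h << a *g m >> = k << a *g m >>) -> h =1 k.
Proof.
move=> hD kD hk p; rewrite [p]monalgE.
elim/big_ind: _ => [|x y hx hy|m _] //.
- by rewrite !morphD_0.
- by rewrite hD kD hx hy.
Qed.

End FiniteSupport.

Section FormalOperators.
Variables (R : realType) (A : lmodType {poly R[i]}) (n : nat).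
Implicit Types (a : A) (p q : formal A n) (m : {cmonom 'I_n}) (i : 'I_n).
Implicit Types (u : {poly R[i]}).

Lemma mulmonomD m : morphD (@mulmonom R A n m).
Proof.
apply: (@msupp_sumD _ _ _ (fun k x => << x *g mmul m k >>)) => k x y.
by rewrite monalgUD.
Qed.

Lemma mulmonomU m a m' :
  mulmonom m << a *g m' >> = << a *g (mmul m m' : {cmonom 'I_n}) >>.
Proof.
by rewrite /mulmonom (msupp_sumU (F := fun k x => << x *g mmul m k >>)) // => k;
  rewrite monalgU0.
Qed.

Lemma actcD u : morphD (@actc R A n u).
Proof.
apply: (@msupp_sumD _ _ _ (fun k x => << u *: x *g k >>)) => k x y.
by rewrite scalerDr monalgUD.
Qed.

Lemma actcU u a m : actc u << a *g m >> = << u *: a *g m >>.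
Proof.
by rewrite /actc (msupp_sumU (F := fun k x => << u *: x *g k >>)) // => k;
  rewrite scaler0 monalgU0.
Qed.

Lemma mulXD i : morphD (@mulX R A n i).
Proof. exact: mulmonomD. Qed.

Lemma mulmonomM m m' p :
  mulmonom m (mulmonom m' p) = mulmonom (mmul m m') p.
Proof.
move: p; apply: morphD_malg_ext => [||a k].
- exact: (morphD_comp (mulmonomD m')) (mulmonomD m).
- exact: mulmonomD.
- by rewrite /= !mulmonomU mulmA.
Qed.

Lemma mulmonom1 p : mulmonom mone p = p.
Proof.
move: p; apply: morphD_malg_ext => [||a k] //; first exact: mulmonomD.
by rewrite mulmonomU mul1m.
Qed.

Lemma mulmonomC m m' p :
  mulmonom m (mulmonom m' p) = mulmonom m' (mulmonom m p).
Proof. by rewrite !mulmonomM mulmC. Qed.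

Lemma actcM u u' p : actc u (actc u' p) = actc (u * u') p.
Proof.
move: p; apply: morphD_malg_ext => [||a k]; last by rewrite /= !actcU scalerA.
- exact: (morphD_comp (actcD u')) (actcD u).
- exact: actcD.
Qed.

Lemma actc_mulmonom u m p : actc u (mulmonom m p) = mulmonom m (actc u p).
Proof.
move: p; apply: morphD_malg_ext => [||a k].
- exact: (morphD_comp (mulmonomD m)) (actcD u).
- exact: (morphD_comp (actcD u)) (mulmonomD m).
- by rewrite /= [in LHS]mulmonomU [LHS]actcU [in RHS]actcU [RHS]mulmonomU.
Qed.

Lemma partial_mulX i : intertwines (@partial R A n) (mulX i) (mulX i).
Proof. by move=> p; exact: actc_mulmonom. Qed.

Lemma formal_ind (P : formal A n -> Prop) :
  (forall a, P a%:MP) -> (forall p q, P p -> P q -> P (p + q)) ->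
  (forall i p, P p -> P (mulX i p)) -> forall p, P p.
Proof.
move=> PC PD PX p; rewrite [p]monalgE; elim/big_ind: _ => // [|m _].
  by rewrite -malgC0E.
have [d] := ubnP (mdeg m); elim: d m p@_m => // d IHd m a; rewrite ltnS => le_d.
have [/mdeg_eq0I -> // | m_gt0] := posnP (mdeg m).
have [i mi] : exists i, m i != 0%N.
  apply/existsP; apply: contraTT m_gt0; rewrite negb_exists => /forallP m0.
  by rewrite -eqn0Ngt mdegE big1 // => i _; apply/eqP/negPn.
have mE : m = mmul (ucm i) (divcm m (ucm i)).
  apply/eqP/cmP => j; rewrite cmM divcmE cmU.
  by case: eqP => [<-|_]; rewrite ?subn0 // addnC subnK // lt0n.
rewrite mE -mulmonomU; apply: (PX i); apply: IHd.
by apply: leq_trans le_d; rewrite [X in (_ < mdeg X)%N]mE mdegM mdegU.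
Qed.

(** Additive maps out of a module of polynomials are compared on constants and
    along multiplication by the variables. *)
Lemma formal_ext (V : zmodType) (h k : formal A n -> V) :
  morphD h -> morphD k -> (forall a, h a%:MP = k a%:MP) ->
  (forall i p, h p = k p -> h (mulX i p) = k (mulX i p)) -> h =1 k.
Proof.
move=> hD kD hC hX; apply: formal_ind => // p q IHp IHq.
by rewrite hD kD IHp IHq.
Qed.

(** Operators induced by the integral linear combinations of partial and of the
    variables. Being generated by commuting operators, they commute with each
    other and with the scalars, which allows any of them to be substituted for
    a variable. *)
Inductive spectral : (formal A n -> formal A n) -> Prop :=
| spectral_mulX i : spectral (mulX i)
| spectral_partial : spectral partial
| spectral_add nu nu' : spectral nu -> spectral nu' -> spectral (nu \+ nu')
| spectral_opp nu : spectral nu -> spectral (\- nu).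

Lemma spectralD nu : spectral nu -> morphD nu.
Proof.
elim=> {nu} [i||nu nu' _ hD _ hD'|nu _ hD].
- exact: mulXD.
- exact: actcD.
- exact: morphD_add.
- exact: morphD_opp.
Qed.

Lemma spectral_intertwines (h : formal A n -> formal A n) nu :
  morphD h -> (forall i, intertwines h (mulX i) (mulX i)) ->
  intertwines h partial partial -> spectral nu -> intertwines h nu nu.
Proof.
move=> hD hX hd; elim=> {nu} [i||nu nu' _ IH _ IH'|nu _ IH].
- exact: hX.
- exact: hd.
- exact: intertwines_add.
- exact: intertwines_opp.
Qed.

Lemma actc_spectral u nu : spectral nu -> intertwines (actc u) nu nu.
Proof.
apply: spectral_intertwines => [|i p|p].
- exact: actcD.
- exact: actc_mulmonom.
- by rewrite /partial [LHS]actcM [RHS]actcM mulrC.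
Qed.

Lemma mulX_spectral i nu : spectral nu -> intertwines (mulX i) nu nu.
Proof.
apply: spectral_intertwines => [|j p|p].
- exact: mulXD.
- exact: mulmonomC.
- by symmetry; exact: partial_mulX.
Qed.

Lemma spectral_comm nu nu' : spectral nu -> spectral nu' ->
  intertwines nu nu' nu'.
Proof.
move=> nuS; apply: spectral_intertwines => [|i p|p].
- exact: spectralD.
- by symmetry; exact: mulX_spectral.
- by symmetry; exact: actc_spectral.
Qed.

End FormalOperators.

(** * Substitution for one variable *)

Section Substitution.
Variables (R : realType) (A : lmodType {poly R[i]}).
Implicit Types (a b c : A) (u : {poly R[i]}).

(** A map out of A[lambda] is determined by its values on constants and by the
    operator that multiplication by lambda turns into. This compares
    compositions of products and substitutions without looking at
    coefficients. *)
Lemma formal1_ext (V : zmodType) (h k : formal A 1 -> V) nu :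
  morphD h -> morphD k -> (forall a, h a%:MP = k a%:MP) ->
  intertwines h lam nu -> intertwines k lam nu -> h =1 k.
Proof.
move=> hD kD hC hX kX; apply: formal_ext => // i p hkp.
by rewrite (ord1 i) [LHS]hX [RHS]kX hkp.
Qed.

Section SubstOne.
Variables (n : nat) (nu : formal A n -> formal A n).
Hypothesis nuD : morphD nu.

Let F (m : {cmonom 'I_1}) a := iter (m ord0) nu (malgC a).

Let FD m : morphD (F m).
Proof. by move=> x y; rewrite /F monalgUD (morphD_iter (m ord0) nuD). Qed.

Lemma substD : morphD (subst nu).
Proof. exact: (msupp_sumD FD). Qed.

Lemma substU a m : subst nu << a *g m >> = iter (m ord0) nu a%:MP.
Proof. exact: (msupp_sumU (F := F) a m (fun k => morphD_0 (@FD k))). Qed.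

Lemma substC a : subst nu a%:MP = a%:MP.
Proof. by rewrite substU cm1. Qed.

Lemma subst_lam : intertwines (subst nu) lam nu.
Proof.
apply: morphD_malg_ext => [||a m].
- exact: morphD_comp (@mulXD _ _ _ ord0) substD.
- exact: morphD_comp substD nuD.
- by rewrite /= /mulX mulmonomU [LHS]substU [in RHS]substU [in LHS]cmM cmUU.
Qed.

End SubstOne.

Lemma subst_id : subst lam =1 id :> (formal A 1 -> formal A 1).
Proof.
have lamD : morphD (lam : formal A 1 -> formal A 1) by exact: mulXD.
apply: (@formal1_ext _ _ _ lam) => //.
- exact: substD.
- exact: substC.
- exact: subst_lam.
Qed.

(** Substitutions compose: a map that fixes constants and carries nu to nu'
    carries the value of w at nu to its value at nu'. *)
Lemma morph_subst n k (h : formal A n -> formal A k) nu nu' w :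
  morphD nu -> morphD nu' -> morphD h -> (forall a, h a%:MP = a%:MP) ->
  intertwines h nu nu' -> h (subst nu w) = subst nu' w.
Proof.
move=> nuD nuD' hD hC hX; move: w; apply: (@formal1_ext _ _ _ nu') => [||a||].
- exact: morphD_comp (substD nuD) hD.
- exact: substD.
- by rewrite [in LHS](substC nuD) [RHS](substC nuD').
- exact: intertwines_comp (subst_lam nuD) hX.
- exact: subst_lam.
Qed.

Section Spectral.
Variables (n : nat) (nu : formal A n -> formal A n).
Hypothesis nuS : spectral nu.

Let nuD := spectralD nuS.

Lemma subst_actc u : intertwines (subst nu) (actc u) (actc u).
Proof.
apply: (@formal1_ext _ _ _ nu) => [||a||].
- exact: morphD_comp (actcD u) (substD nuD).
- exact: morphD_comp (substD nuD) (actcD u).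
- by rewrite [in LHS]actcU [LHS](substC nuD) [in RHS](substC nuD) [RHS]actcU.
- exact: intertwines_comp (actc_spectral u (spectral_mulX A _)) (subst_lam nuD).
- exact: intertwines_comp (subst_lam nuD) (actc_spectral u nuS).
Qed.

Lemma subst_subst w :
  subst nu (subst (\- partial \- lam) w) = subst (\- partial \- nu) w.
Proof.
apply: morph_subst.
- apply: spectralD; apply: spectral_add; apply: spectral_opp.
    exact: spectral_partial.
  exact: spectral_mulX.
- apply: spectralD; apply: spectral_add; apply: spectral_opp; last exact: nuS.
  exact: spectral_partial.
- exact: substD.
- exact: substC.
apply: intertwines_add; first exact: substD.
  by apply: intertwines_opp; [exact: substD | exact: subst_actc].
by apply: intertwines_opp; [exact: substD | exact: subst_lam].
Qed.

End Spectral.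
End Substitution.

(** * Products and their opposites *)

Section FormalProduct.
Variables (R : realType) (A : lmodType {poly R[i]}).
Implicit Types (a b c : A) (f g : A -> A -> formal A 1).

Lemma fprod_sub n (nu : formal A n -> formal A n) f g p q : morphD nu ->
  p *_[fun a b => f a b - g a b, nu] q = p *_[f, nu] q - p *_[g, nu] q.
Proof.
move=> nuD; rewrite -sumrB; apply: eq_bigr => m _; rewrite -sumrB.
apply: eq_bigr => m' _.
by rewrite (morphD_B (substD nuD)) (morphD_B (mulmonomD _)).
Qed.

Section Conformal.
Variables (f : A -> A -> formal A 1) (n : nat) (nu : formal A n -> formal A n).
Hypotheses (fA : conformal_algebra f) (nuS : spectral nu).
Implicit Types (p q : formal A n).

Let F (m : {cmonom 'I_n}) a (m' : {cmonom 'I_n}) b :=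
  mulmonom (mmul m m') (subst nu (f a b)).

Let nuD := spectralD nuS.

Let FDr m a m' : morphD (F m a m').
Proof.
by move=> x y; rewrite /F (conformalDr fA) (substD nuD) mulmonomD.
Qed.

Let FDl q m : morphD (fun a => \sum_(m' <- msupp q) F m a m' q@_m').
Proof.
move=> x y; rewrite -big_split; apply: eq_bigr => m' _ /=.
by rewrite /F (conformalDl fA) (substD nuD) mulmonomD.
Qed.

Lemma fprodDl q : morphD (fun p => p *_[f, nu] q).
Proof. exact: (msupp_sumD (FDl q)). Qed.

Lemma fprodDr p : morphD (fun q => p *_[f, nu] q).
Proof.
move=> x y; rewrite -big_split; apply: eq_bigr => m _ /=.
exact: (msupp_sumD (FDr m p@_m)).
Qed.

Lemma fprodU a m b m' :
  << a *g m >> *_[f, nu] << b *g m' >>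
  = mulmonom (mmul m m') (subst nu (f a b)).
Proof.
transitivity (\sum_(k <- msupp << b *g m' >>) F m a k << b *g m' >>@_k).
  exact: (msupp_sumU (F := fun m a => \sum_(k <- _) F m a k _) a m
            (fun m => morphD_0 (FDl _ m))).
exact: (msupp_sumU (F := F m a) b m' (fun k => morphD_0 (@FDr m a k))).
Qed.

Lemma fprodC a b : a%:MP *_[f, nu] b%:MP = subst nu (f a b).
Proof. by rewrite fprodU mul1m mulmonom1. Qed.

Lemma fprod_mulXl q i :
  intertwines (fun p => p *_[f, nu] q) (mulX i) (mulX i).
Proof.
apply: morphD_malg_ext => [||a m].
- exact: morphD_comp (mulXD i) (fprodDl q).
- exact: morphD_comp (fprodDl q) (mulXD i).
move: q; apply: morphD_malg_ext => [||b m'].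
- exact: fprodDr.
- exact: morphD_comp (fprodDr _) (mulXD i).
by rewrite /mulX [in LHS]mulmonomU [LHS]fprodU [in RHS]fprodU
  [RHS]mulmonomM mulmA.
Qed.

Lemma fprod_mulXr p i : intertwines (fun q => p *_[f, nu] q) (mulX i) (mulX i).
Proof.
move=> q; move: p; apply: morphD_malg_ext => [||a m].
- exact: fprodDl.
- exact: morphD_comp (fprodDl q) (mulXD i).
move: q; apply: morphD_malg_ext => [||b m'].
- exact: morphD_comp (mulXD i) (fprodDr _).
- exact: morphD_comp (fprodDr _) (mulXD i).
rewrite /mulX [in LHS]mulmonomU [LHS]fprodU [in RHS]fprodU [RHS]mulmonomM.
by rewrite [in LHS]mulmA [mmul m _]mulmC -[in LHS]mulmA.
Qed.

(** The rule for a f_lambda (partial b) survives extension of the product to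
    polynomials and substitution for lambda. *)
Lemma fprod_partialr a :
  intertwines (fun q => a%:MP *_[f, nu] q) partial (partial \+ nu).
Proof.
have dS : spectral (partial \+ nu).
  exact: spectral_add (spectral_partial _ _) nuS.
apply: formal_ext => [||b|i q IHq].
- exact: morphD_comp (actcD _) (fprodDr _).
- exact: morphD_comp (fprodDr _) (spectralD dS).
- rewrite /partial [in LHS]actcU [LHS]fprodC (conformal_partialr fA).
  rewrite [LHS](substD nuD) [in RHS]fprodC /=.
  by congr (_ + _); [exact: subst_actc | exact: subst_lam].
- rewrite [in LHS]partial_mulX.
  rewrite [LHS]fprod_mulXr [in LHS]IHq [in RHS]fprod_mulXr.
  exact: (mulX_spectral _ dS).
Qed.

End Conformal.

Definition opposite f a b : formal A 1 := subst (\- partial \- lam) (f b a).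

Let opS : spectral (\- partial \- lam : formal A 1 -> formal A 1).
Proof.
exact/spectral_add/spectral_opp/spectral_mulX/spectral_opp/spectral_partial.
Qed.

(** Substituting - partial - lambda twice gives back lambda. *)
Lemma oppositeK f : opposite (opposite f) = f.
Proof.
apply/funext => a; apply/funext => b; rewrite /opposite subst_subst //.
transitivity (subst lam (f a b) : formal A 1); last exact: subst_id.
congr (subst _ _); apply/funext => p /=.
by rewrite opprB addrC subrK.
Qed.

Lemma opposite_conformal f :
  conformal_algebra f -> conformal_algebra (opposite f).
Proof.
move=> fA; have oD := spectralD opS.
split=> [a b c|a b c|z a b|z a b|a b|a b]; rewrite /opposite.
- by rewrite (conformalDr fA) (substD oD).
- by rewrite (conformalDl fA) (substD oD).
- by rewrite (conformalZr fA) (subst_actc opS).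
- by rewrite (conformalZl fA) (subst_actc opS).
- rewrite (conformal_partialr fA) [LHS](substD oD).
  rewrite [X in _ + X](subst_lam oD) [X in X + _](subst_actc opS) /=.
  rewrite -/partial; move: (partial _) (lam _) => v w.
  by rewrite addrA subrr sub0r.
- rewrite (conformal_partiall fA) [LHS](morphD_N (substD oD)).
  rewrite [X in - X = _](subst_lam oD) /=.
  by move: (partial _) (lam _) => v w; rewrite opprB opprK addrC.
Qed.

Lemma sub_conformal f g : conformal_algebra f -> conformal_algebra g ->
  conformal_algebra (fun a b => f a b - g a b).
Proof.
move=> fA gA; have pD : morphD (@partial R A 1) by exact: actcD.
split=> [a b c|a b c|z a b|z a b|a b|a b].
- by rewrite (conformalDl fA) (conformalDl gA) opprD addrACA.
- by rewrite (conformalDr fA) (conformalDr gA) opprD addrACA.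
- by rewrite (conformalZl fA) (conformalZl gA) [RHS](morphD_B (actcD _)).
- by rewrite (conformalZr fA) (conformalZr gA) [RHS](morphD_B (actcD _)).
- rewrite (conformal_partiall fA) (conformal_partiall gA).
  by rewrite [in RHS](morphD_B (mulXD _)) opprD.
- rewrite (conformal_partialr fA) (conformal_partialr gA).
  rewrite [X in _ = _ + X](morphD_B (mulXD _)) [X in _ = X + _](morphD_B pD).
  by rewrite opprD addrACA.
Qed.

Lemma conformal_commutatorE f : conformal_algebra f ->
  conformal_commutator f = (fun a b => f a b - opposite f a b).
Proof.
move=> fA; apply/funext => a; apply/funext => b; rewrite /conformal_commutator.
congr (_ - _); last exact: fprodC.
by rewrite [LHS](fprodC fA) ?subst_id //; exact: spectral_mulX.
Qed.

Lemma commutator_conformal f : conformal_algebra f ->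
  conformal_algebra (conformal_commutator f).
Proof.
move=> fA; rewrite conformal_commutatorE //.
exact: sub_conformal (opposite_conformal fA).
Qed.

Lemma opposite_commutator f : conformal_algebra f ->
  opposite (conformal_commutator f) = (fun a b => - conformal_commutator f a b).
Proof.
move=> fA; rewrite conformal_commutatorE //.
apply/funext => a; apply/funext => b; rewrite /opposite.
rewrite [LHS](morphD_B (substD (spectralD opS))) opprB; congr (_ - _).
exact: (congr1 (fun h => h a b) (oppositeK f)).
Qed.

(** * Substitution for two variables *)

(** The order of nu1 and nu2 is immaterial for spectral operators, as they
    commute. *)
Definition subst2 n (nu1 nu2 : formal A n -> formal A n) (p : formal A 2) :
    formal A n :=
  \sum_(m <- msupp p) iter (m ord0) nu1 (iter (m ord_max) nu2 (malgC p@_m)).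

Definition sel2 (T : Type) (t1 t2 : T) (i : 'I_2) :=
  if i == ord0 then t1 else t2.

Lemma ord2P (i : 'I_2) : i = ord0 \/ i = ord_max.
Proof. by case: i => [[|[|//]] lti]; [left | right]; exact: val_inj. Qed.

Section SubstTwo.
Variables (n : nat) (nu1 nu2 : formal A n -> formal A n).
Hypotheses (nuS1 : spectral nu1) (nuS2 : spectral nu2).

Let nuD1 := spectralD nuS1.
Let nuD2 := spectralD nuS2.

Let F (m : {cmonom 'I_2}) a :=
  iter (m ord0) nu1 (iter (m ord_max) nu2 (malgC a)).

Let FD m : morphD (F m).
Proof.
move=> x y.
by rewrite /F monalgUD (morphD_iter _ nuD2) (morphD_iter _ nuD1).
Qed.

Lemma subst2D : morphD (subst2 nu1 nu2).
Proof. exact: (msupp_sumD FD). Qed.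

Lemma subst2U a m : subst2 nu1 nu2 << a *g m >> = F m a.
Proof. exact: (msupp_sumU (F := F) a m (fun k => morphD_0 (@FD k))). Qed.

Lemma subst2C a : subst2 nu1 nu2 a%:MP = a%:MP.
Proof. by rewrite [LHS]subst2U /F !cm1. Qed.

Lemma sel2_spectral i : spectral (sel2 nu1 nu2 i).
Proof. by rewrite /sel2; case: ifP. Qed.

Lemma subst2_mulX i :
  intertwines (subst2 nu1 nu2) (mulX i) (sel2 nu1 nu2 i).
Proof.
apply: morphD_malg_ext => [||a m].
- exact: morphD_comp (@mulXD _ _ _ i) subst2D.
- exact: morphD_comp subst2D (spectralD (sel2_spectral i)).
rewrite /mulX mulmonomU [LHS]subst2U [in RHS]subst2U /F.
rewrite ![in LHS]cmM !cmU /sel2.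
have [->|->] := ord2P i => //=.
by elim: (m ord0) => //= k ->; rewrite [LHS](spectral_comm nuS1 nuS2).
Qed.

Lemma subst2_partial : intertwines (subst2 nu1 nu2) partial partial.
Proof.
apply: formal_ext => [||a|i p /= IHp].
- exact: morphD_comp (actcD _) subst2D.
- exact: morphD_comp subst2D (actcD _).
- by rewrite /partial [in LHS]actcU [LHS]subst2C [in RHS]subst2C [RHS]actcU.
- rewrite [in LHS]partial_mulX.
  rewrite [LHS]subst2_mulX [in LHS]IHp [in RHS]subst2_mulX.
  by symmetry; exact: (actc_spectral 'X (sel2_spectral i)).
Qed.

Lemma subst2_subst nu nu' w : spectral nu -> spectral nu' ->
  intertwines (subst2 nu1 nu2) nu nu' ->
  subst2 nu1 nu2 (subst nu w) = subst nu' w.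
Proof.
move=> nuS nuS'; apply: morph_subst.
- exact: spectralD.
- exact: spectralD.
- exact: subst2D.
- exact: subst2C.
Qed.

(** The next two sections collect what [formal1_ext] needs in order to compare
    two iterated products, regarded as functions of the value w of the inner
    product. *)
Section RightHole.
Variables (f : A -> A -> formal A 1) (a : A) (i : 'I_2).
Hypothesis fA : conformal_algebra f.

Let XiS : spectral (mulX i : formal A 2 -> formal A 2) := spectral_mulX A i.

Lemma right_holeD nu : morphD nu ->
  morphD (fun w => subst2 nu1 nu2 (a%:MP *_[f, mulX i] subst nu w)).
Proof.
move=> nuD.
exact: morphD_comp (morphD_comp (substD nuD) (fprodDr fA XiS _)) subst2D.
Qed.

Lemma right_holeC nu b : morphD nu ->
  subst2 nu1 nu2 (a%:MP *_[f, mulX i] subst nu b%:MP)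
  = subst (sel2 nu1 nu2 i) (f a b).
Proof.
move=> nuD; rewrite [in LHS](substC nuD) [in LHS](fprodC fA XiS).
exact: subst2_subst (sel2_spectral i) (subst2_mulX i).
Qed.

Lemma right_hole_lam nu nu' nu'' : morphD nu ->
  intertwines (fun q => a%:MP *_[f, mulX i] q) nu nu' ->
  intertwines (subst2 nu1 nu2) nu' nu'' ->
  intertwines (fun w => subst2 nu1 nu2 (a%:MP *_[f, mulX i] subst nu w))
    lam nu''.
Proof.
move=> nuD h1 h2.
exact: intertwines_comp (intertwines_comp (subst_lam nuD) h1) h2.
Qed.

End RightHole.

Section LeftHole.
Variables (g : A -> A -> formal A 1) (c : A) (i : 'I_2).
Hypothesis gA : conformal_algebra g.

Let XiD : morphD (mulX i : formal A 2 -> formal A 2) := mulXD i.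
Let XS : spectral (lam \+ mu : formal A 2 -> formal A 2).
Proof. exact: spectral_add (spectral_mulX A _) (spectral_mulX A _). Qed.

Lemma left_holeD :
  morphD (fun w => subst2 nu1 nu2 (subst (mulX i) w *_[g, lam \+ mu] c%:MP)).
Proof.
exact: morphD_comp (morphD_comp (substD XiD) (fprodDl gA XS _)) subst2D.
Qed.

Lemma left_holeC b :
  subst2 nu1 nu2 (subst (mulX i) b%:MP *_[g, lam \+ mu] c%:MP)
  = subst (nu1 \+ nu2) (g b c).
Proof.
rewrite [in LHS](substC XiD) [in LHS](fprodC gA XS).
apply: subst2_subst => //; first exact: spectral_add.
apply: intertwines_add; [exact: subst2D| exact: subst2_mulX|].
exact: (@subst2_mulX ord_max).
Qed.

Lemma left_hole_lam :
  intertwines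
    (fun w => subst2 nu1 nu2 (subst (mulX i) w *_[g, lam \+ mu] c%:MP))
    lam (sel2 nu1 nu2 i).
Proof.
exact: intertwines_comp (intertwines_comp (subst_lam XiD)
  (fprod_mulXl gA XS c%:MP i)) (subst2_mulX i).
Qed.

End LeftHole.
End SubstTwo.

Lemma subst2_id : subst2 lam mu =1 id :> (formal A 2 -> formal A 2).
Proof.
have lamS := spectral_mulX A (ord0 : 'I_2).
have muS := spectral_mulX A (ord_max : 'I_2).
apply: formal_ext => [||a|i p /= IHp].
- exact: subst2D.
- by [].
- exact: subst2C.
- rewrite [LHS]subst2_mulX //.
  by have [->|->] := ord2P i; rewrite /sel2 /= [in LHS]IHp.
Qed.

End FormalProduct.

(** * Iterated products of three slots *)

Section Slots.
Variables (R : realType) (A : lmodType {poly R[i]}).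

(** An argument together with the operator that replaces its spectral
    variable. *)
Definition slot : Type := ((formal A 2 -> formal A 2) * A)%type.

Implicit Types (a b c : A) (f g h : A -> A -> formal A 1) (x y z : slot).

(** Three slots carry two independent variables: [balanced] below determines the
    operator of the last slot from the other two. *)
Definition nest_right f g x y z : formal A 2 :=
  subst2 x.1 y.1 (x.2%:MP *_[f, lam] (y.2%:MP *_[g, mu] z.2%:MP)).

Definition nest_left f g x y z : formal A 2 :=
  subst2 x.1 y.1 ((x.2%:MP *_[f, lam] y.2%:MP) *_[g, lam \+ mu] z.2%:MP).

(** The condition is symmetric in the three slots, so that every law stated for
    balanced slots may be permuted. *)
Record balanced x y z : Prop := Balanced {
  balanced1 : spectral x.1;
  balanced2 : spectral y.1;
  balanced3 : spectral z.1;
  balanced_sum : forall p, x.1 p + y.1 p + z.1 p = - partial p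
}.

Lemma balanced_swap x y z : balanced x y z -> balanced y x z.
Proof. by case=> ? ? ? E; split=> // p; rewrite -E [y.1 p + _]addrC. Qed.

Lemma balanced_rot x y z : balanced x y z -> balanced z x y.
Proof. by case=> ? ? ? E; split=> // p; rewrite -E -addrA [LHS]addrC. Qed.

Let lamS : spectral (lam : formal A 2 -> formal A 2) := spectral_mulX A _.
Let muS : spectral (mu : formal A 2 -> formal A 2) := spectral_mulX A _.
Let lammuS : spectral (lam \+ mu : formal A 2 -> formal A 2).
Proof. exact: spectral_add. Qed.
Let dmuS : spectral (\- partial \- mu : formal A 2 -> formal A 2).
Proof. exact/spectral_add/spectral_opp/muS/spectral_opp/spectral_partial. Qed.

Section Nest.
Variables f g : A -> A -> formal A 1.
Hypotheses (fA : conformal_algebra f) (gA : conformal_algebra g).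

(** In an identity at lambda and mu, the terms where the second argument comes
    first become, after substitution, the same expression in permuted slots. *)
Lemma subst2_nest_swap x y z : spectral x.1 -> spectral y.1 ->
  subst2 x.1 y.1 (y.2%:MP *_[f, mu] (x.2%:MP *_[g, lam] z.2%:MP))
  = nest_right f g y x z.
Proof.
move=> xS yS; rewrite /nest_right.
rewrite [in LHS](fprodC gA lamS) [in RHS](fprodC gA muS).
move: (g _ _); apply: (@formal1_ext _ _ _ _ _ x.1) => [||b||].
- by apply: right_holeD => //; exact: spectralD.
- by apply: right_holeD => //; exact: spectralD.
- rewrite [LHS](right_holeC xS yS _ _ fA _ (spectralD lamS)).
  by rewrite [RHS](right_holeC yS xS _ _ fA _ (spectralD muS)).
- apply: (@right_hole_lam _ _ _ _ _ _ _ _ lam lam); first exact: spectralD.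
    exact: fprod_mulXr.
  exact: (subst2_mulX xS yS ord0).
- apply: (@right_hole_lam _ _ _ _ _ _ _ _ mu mu); first exact: spectralD.
    exact: fprod_mulXr.
  exact: (subst2_mulX yS xS ord_max).
Qed.

Lemma subst2_nest_left_swap x y z : spectral x.1 -> spectral y.1 ->
  subst2 x.1 y.1 ((y.2%:MP *_[f, mu] x.2%:MP) *_[g, lam \+ mu] z.2%:MP)
  = nest_left f g y x z.
Proof.
move=> xS yS; rewrite /nest_left.
rewrite [in LHS](fprodC fA muS) [in RHS](fprodC fA lamS).
move: (f _ _); apply: (@formal1_ext _ _ _ _ _ y.1) => [||b||].
- exact: left_holeD.
- exact: left_holeD.
- rewrite [LHS](left_holeC xS yS _ _ gA) [RHS](left_holeC yS xS _ _ gA).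
  by congr subst; apply/funext => p /=; rewrite addrC.
- exact: left_hole_lam.
- exact: left_hole_lam.
Qed.

(** Inside, the opposite product carries - partial - nu2. Moved past the outer
    product, partial becomes partial + nu1, and - partial - nu1 - nu2 is the
    operator of the third slot. *)
Lemma nest_right_oppositer x y z : balanced x y z ->
  nest_right f (opposite g) x y z = nest_right f g x z y.
Proof.
case=> xS yS zS E; rewrite /nest_right.
rewrite [in LHS](fprodC (opposite_conformal gA) muS) [in RHS](fprodC gA muS).
rewrite /opposite [in LHS](subst_subst muS).
move: (g _ _); apply: (@formal1_ext _ _ _ _ _ z.1) => [||b||].
- by apply: right_holeD => //; exact: spectralD.
- by apply: right_holeD => //; exact: spectralD.
- rewrite [LHS](right_holeC xS yS _ _ fA _ (spectralD dmuS)).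
  by rewrite [RHS](right_holeC xS zS _ _ fA _ (spectralD muS)).
- have -> : z.1 = \- (partial \+ x.1) \- y.1.
    apply/funext => p /=; have -> : partial p = - (x.1 p + y.1 p + z.1 p).
      by rewrite E opprK.
    move: (x.1 p) (y.1 p) (z.1 p) => u v w.
    by rewrite opprD opprK -addrA -opprD [_ + w]addrC addrK.
  have fD := fprodDr fA lamS x.2%:MP; have sD := subst2D xS yS.
  apply: (@right_hole_lam _ _ _ _ _ _ _ _ _ (\- (partial \+ lam) \- mu)).
  + exact: spectralD.
  + apply: (intertwines_add fD); apply: (intertwines_opp fD).
      exact: fprod_partialr.
    exact: fprod_mulXr.
  + apply: (intertwines_add sD); apply: (intertwines_opp sD).
      apply: (intertwines_add sD); first exact: subst2_partial.
      exact: (subst2_mulX xS yS ord0).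
    exact: (subst2_mulX xS yS ord_max).
- apply: (@right_hole_lam _ _ _ _ _ _ _ _ mu mu); first exact: spectralD.
    exact: fprod_mulXr.
  exact: (subst2_mulX xS zS ord_max).
Qed.

(** As a product of xy and z, (xy)z is the opposite product of z and xy. The
    slot of xy carries nu1 + nu2 = - partial - nu3, so it is the operator nu3 of
    z that becomes the outer variable. *)
Lemma nest_leftE x y z : balanced x y z ->
  nest_left f g x y z = nest_right (opposite g) f z x y.
Proof.
case=> xS yS zS E; have hA := opposite_conformal gA.
rewrite /nest_left /nest_right.
rewrite [in LHS](fprodC fA lamS) [in RHS](fprodC fA muS).
move: (f _ _); apply: (@formal1_ext _ _ _ _ _ x.1) => [||b||].
- exact: left_holeD.
- by apply: right_holeD => //; exact: spectralD.
- rewrite [LHS](left_holeC xS yS _ _ gA).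
  rewrite [RHS](right_holeC zS xS _ _ hA _ (spectralD muS)).
  rewrite /opposite [RHS](subst_subst zS).
  congr subst; apply/funext => p /=; rewrite -E.
  by move: (x.1 p) (y.1 p) (z.1 p) => u v w; rewrite addrK.
- exact: left_hole_lam.
- apply: (@right_hole_lam _ _ _ _ _ _ _ _ mu mu); first exact: spectralD.
    exact: fprod_mulXr.
  exact: (subst2_mulX zS xS ord_max).
Qed.

End Nest.

Section Opposites.
Variables f g : A -> A -> formal A 1.
Hypotheses (fA : conformal_algebra f) (gA : conformal_algebra g).

Let fA' := opposite_conformal fA.
Let gA' := opposite_conformal gA.

Lemma nest_left_oppositer x y z : balanced x y z ->
  nest_left f (opposite g) x y z = nest_right g f z x y.
Proof. by move=> bal; rewrite (nest_leftE fA gA' bal) oppositeK. Qed.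

Lemma nest_right_oppositel x y z : balanced x y z ->
  nest_right (opposite f) g x y z = nest_left g f y z x.
Proof.
by move=> bal; rewrite (nest_leftE gA fA (balanced_rot (balanced_rot bal))).
Qed.

Lemma nest_left_oppositel x y z : balanced x y z ->
  nest_left (opposite f) g x y z = nest_left f g y x z.
Proof.
move=> bal; have bal' := balanced_rot bal.
rewrite (nest_leftE fA' gA bal) (nest_right_oppositer gA' fA bal').
by rewrite (nest_leftE fA gA (balanced_swap bal)).
Qed.

End Opposites.

Section Sub.
Variables f g h : A -> A -> formal A 1.
Hypothesis hA : conformal_algebra h.

Lemma nest_right_subl x y z : spectral x.1 -> spectral y.1 ->
  nest_right (fun a b => f a b - g a b) h x y z
  = nest_right f h x y z - nest_right g h x y z.
Proof.
move=> xS yS; rewrite /nest_right fprod_sub; last exact: spectralD.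
exact: (morphD_B (subst2D xS yS)).
Qed.

Lemma nest_right_subr x y z : spectral x.1 -> spectral y.1 ->
  nest_right h (fun a b => f a b - g a b) x y z
  = nest_right h f x y z - nest_right h g x y z.
Proof.
move=> xS yS; rewrite /nest_right fprod_sub; last exact: spectralD.
rewrite [in LHS](morphD_B (fprodDr hA lamS _)).
exact: (morphD_B (subst2D xS yS)).
Qed.

Lemma nest_left_subl x y z : spectral x.1 -> spectral y.1 ->
  nest_left (fun a b => f a b - g a b) h x y z
  = nest_left f h x y z - nest_left g h x y z.
Proof.
move=> xS yS; rewrite /nest_left fprod_sub; last exact: spectralD.
rewrite [in LHS](morphD_B (fprodDl hA lammuS _)).
exact: (morphD_B (subst2D xS yS)).
Qed.

Lemma nest_left_subr x y z : spectral x.1 -> spectral y.1 ->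
  nest_left h (fun a b => f a b - g a b) x y z
  = nest_left h f x y z - nest_left h g x y z.
Proof.
move=> xS yS; rewrite /nest_left fprod_sub; last exact: spectralD.
exact: (morphD_B (subst2D xS yS)).
Qed.

End Sub.

Section Commutator.
Variable g : A -> A -> formal A 1.
Hypothesis gA : conformal_algebra g.

Let br := conformal_commutator g.

Lemma nest_right_commutatorr f x y z :
  conformal_algebra f -> balanced x y z ->
  nest_right f br x y z = nest_right f g x y z - nest_right f g x z y.
Proof.
move=> fA bal; have [xS yS zS _] := bal.
rewrite /br (conformal_commutatorE gA).
rewrite [LHS](nest_right_subr g (opposite g) fA z xS yS).
by rewrite (nest_right_oppositer fA gA bal).
Qed.

Lemma nest_right_commutatorl f x y z :
  conformal_algebra f -> balanced x y z ->
  nest_right br f x y z = nest_right g f x y z - nest_left f g y z x.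
Proof.
move=> fA bal; have [xS yS zS _] := bal.
rewrite /br (conformal_commutatorE gA).
rewrite [LHS](nest_right_subl g (opposite g) f z xS yS).
by rewrite (nest_right_oppositel gA fA bal).
Qed.

Lemma nest_left_commutatorr f x y z :
  conformal_algebra f -> balanced x y z ->
  nest_left f br x y z = nest_left f g x y z - nest_right g f z x y.
Proof.
move=> fA bal; have [xS yS zS _] := bal.
rewrite /br (conformal_commutatorE gA).
rewrite [LHS](nest_left_subr g (opposite g) f z xS yS).
by rewrite (nest_left_oppositer fA gA bal).
Qed.

Lemma nest_left_commutatorl f x y z :
  conformal_algebra f -> balanced x y z ->
  nest_left br f x y z = nest_left g f x y z - nest_left g f y x z.
Proof.
move=> fA bal; have [xS yS zS _] := bal.
rewrite /br (conformal_commutatorE gA).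
rewrite [LHS](nest_left_subl g (opposite g) fA z xS yS).
by rewrite (nest_left_oppositel gA fA bal).
Qed.

End Commutator.

(** * Laws for balanced slots *)

Section Laws.
Variables f g : A -> A -> formal A 1.
Hypotheses (fA : conformal_algebra f) (gA : conformal_algebra g).

Let br := conformal_commutator g.
Let brA : conformal_algebra br := commutator_conformal gA.

Lemma comm_oppositeE : (forall a b,
    a%:MP *_[f, lam] b%:MP
    = b%:MP *_[f, \- partial \- lam] a%:MP :> formal A 1) ->
  opposite f = f.
Proof.
move=> fC; apply/funext => a; apply/funext => b; rewrite /opposite.
have lS := spectral_mulX A (ord0 : 'I_1).
have oS : spectral (\- partial \- lam : formal A 1 -> formal A 1).
  exact: spectral_add (spectral_opp (spectral_partial _ _)) (spectral_opp lS).
have := fC a b.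
rewrite [X in X = _ -> _](fprodC fA lS) [X in _ = X -> _](fprodC fA oS).
by rewrite subst_id.
Qed.

Lemma nest_left_symmetric : (forall a b c,
    (a%:MP *_[g, lam] b%:MP) *_[g, lam \+ mu] c%:MP
      - a%:MP *_[g, lam] (b%:MP *_[g, mu] c%:MP)
    = (b%:MP *_[g, mu] a%:MP) *_[g, lam \+ mu] c%:MP
      - b%:MP *_[g, mu] (a%:MP *_[g, lam] c%:MP) :> formal A 2) ->
  forall x y z, balanced x y z ->
  nest_left g g x y z - nest_right g g x y z
  = nest_left g g y x z - nest_right g g y x z.
Proof.
move=> ls x y z [xS yS _ _]; have sB := morphD_B (subst2D xS yS).
rewrite -(subst2_nest_swap gA gA z xS yS).
rewrite -(subst2_nest_left_swap gA gA z xS yS).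
exact: etrans (esym (sB _ _)) (etrans (congr1 _ (ls x.2 y.2 z.2)) (sB _ _)).
Qed.

Lemma nest_leibniz : conformal_leibniz f g -> forall x y z, balanced x y z ->
  nest_right g f x y z = nest_left g f x y z + nest_right f g y x z.
Proof.
move=> lb x y z [xS yS _ _]; have sD := subst2D xS yS.
rewrite -(subst2_nest_swap fA gA z xS yS).
exact: etrans (congr1 _ (lb x.2 y.2 z.2)) (sD _ _).
Qed.

Lemma nest_compat : conformal_module_compat f g ->
  forall x y z, nest_left f g x y z = nest_right f g x y z.
Proof. by move=> cp x y z; rewrite /nest_left cp. Qed.

(** Left-symmetry is used for the pairs exchanged in (x, y, z), (z, x, y) and
    (y, z, x): its associators account for all twelve terms of the Jacobi
    identity. *)
Lemma nest_jacobi :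
  (forall x y z, balanced x y z ->
    nest_left g g x y z - nest_right g g x y z
    = nest_left g g y x z - nest_right g g y x z) ->
  forall x y z, balanced x y z ->
  nest_right br br x y z = nest_left br br x y z + nest_right br br y x z.
Proof.
move=> ls x y z bal.
have bxzy := balanced_rot (balanced_rot (balanced_swap bal)).
have byxz := balanced_swap bal.
have byzx := balanced_rot (balanced_rot bal).
have bzxy := balanced_rot bal.
rewrite [X in X = _](nest_right_commutatorr gA brA bal).
rewrite [X in _ = X + _](nest_left_commutatorl gA brA bal).
rewrite [X in _ = _ + X](nest_right_commutatorr gA brA byxz).
rewrite [X in X - _ = _](nest_right_commutatorl gA gA bal).
rewrite [X in _ - X = _](nest_right_commutatorl gA gA bxzy).
rewrite [X in _ = X - _ + _](nest_left_commutatorr gA gA bal).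
rewrite [X in _ = _ - X + _](nest_left_commutatorr gA gA byxz).
rewrite [X in _ = _ + (X - _)](nest_right_commutatorl gA gA byxz).
rewrite [X in _ = _ + (_ - X)](nest_right_commutatorl gA gA byzx).
exact: jacobi_zmod (ls _ _ _ bal) (ls _ _ _ byzx) (ls _ _ _ bzxy).
Qed.

(** The Leibniz rule leaves the two terms (z * x)y and (y * x)z over, and they
    agree because commutativity and (xy) * z = x(y * z) turn both into
    (yz) * x. *)
Lemma nest_transposed : opposite f = f ->
  (forall x y z, balanced x y z ->
    nest_right g f x y z = nest_left g f x y z + nest_right f g y x z) ->
  (forall x y z, nest_left f g x y z = nest_right f g x y z) ->
  forall x y z, balanced x y z ->
  nest_right f br x y z *+ 2 = nest_left f br x y z + nest_right br f y x z.
Proof.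
move=> fC lb cp x y z bal.
have byxz := balanced_swap bal; have bzxy := balanced_rot bal.
have byzx := balanced_rot bzxy.
rewrite [X in X *+ 2](nest_right_commutatorr gA fA bal).
rewrite [X in _ = X + _](nest_left_commutatorr gA fA bal).
rewrite [X in _ = _ + X](nest_right_commutatorl gA fA byxz).
rewrite [X in _ = _ - X + _](lb _ _ _ bzxy).
rewrite [X in _ = _ + (X - _)](lb _ _ _ byxz).
rewrite [X in _ = X - _ + _]cp [X in _ = _ + (_ - X)]cp.
have gfC u v w : balanced u v w -> nest_left g f u v w = nest_left f g w u v.
  move=> bal'; rewrite [RHS]cp [LHS](nest_leftE gA fA bal').
  exact (congr1 (fun h => nest_right h g w u v) fC).
have fgC u v w : balanced u v w -> nest_left f g u v w = nest_left f g v u w.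
  move=> bal'; rewrite -[RHS](nest_left_oppositel fA gA bal').
  exact (congr1 (fun h => nest_left h g u v w) (esym fC)).
have -> : nest_left g f z x y = nest_left g f y x z.
  rewrite [LHS](gfC _ _ _ bzxy) [RHS](gfC _ _ _ byxz); exact: fgC.
move: (nest_right f g x y z) (nest_right f g x z y) (nest_left g f y x z).
move=> u v w.
rewrite mulr2n opprD !addrA [RHS](ACl ((1*3)*(5*6)*(2*4)))/= addNr addr0.
by rewrite addrA.
Qed.

End Laws.
End Slots.

(** * The transposed Poisson structure *)

Section Conclusion.
Variables (R : realType) (A : lmodType {poly R[i]}).
Implicit Types (a b c : A) (f g h : A -> A -> formal A 1).

Let lamS : spectral (lam : formal A 2 -> formal A 2) := spectral_mulX A _.
Let muS : spectral (mu : formal A 2 -> formal A 2) := spectral_mulX A _.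

(** The triple at which the laws for slots become the defining identities in
    lambda and mu. *)
Lemma balanced_standard a b c :
  balanced (lam, a) (mu, b) (\- partial \- lam \- mu, c).
Proof.
have dS := spectral_partial A 2.
split; [exact: lamS | exact: muS | | move=> p /=].
  exact: spectral_add (spectral_add (spectral_opp dS) (spectral_opp lamS))
    (spectral_opp muS).
move: (lam p) (mu p) (partial p) => u v w.
by rewrite [LHS]addrC -[_ - u - v]addrA -opprD subrK.
Qed.

Lemma commutator_skew g : conformal_algebra g -> forall a b,
  a%:MP *_[conformal_commutator g, lam] b%:MP
  = - (b%:MP *_[conformal_commutator g, \- lam \- partial] a%:MP)
  :> formal A 1.
Proof.
move=> gA a b; have brA := commutator_conformal gA.
have lS := spectral_mulX A (ord0 : 'I_1).
have oS : spectral (\- lam \- partial : formal A 1 -> formal A 1).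
  exact: spectral_add (spectral_opp lS) (spectral_opp (spectral_partial _ _)).
rewrite [LHS](fprodC brA lS) [LHS]subst_id [X in - X](fprodC brA oS).
have -> : \- lam \- partial = \- partial \- lam :> (formal A 1 -> formal A 1).
  by apply/funext => p; exact: addrC.
rewrite -[X in _ = - X]/(opposite (conformal_commutator g) a b).
by rewrite (opposite_commutator gA) opprK.
Qed.

Lemma nest_at_lam_mu (u v w : formal A 2) :
  subst2 lam mu u = subst2 lam mu v + subst2 lam mu w -> u = v + w.
Proof. by rewrite !subst2_id. Qed.

Lemma commutator_lie g : left_symmetric_conformal g ->
  lie_conformal (conformal_commutator g).
Proof.
case=> gA ls; have brA := commutator_conformal gA.
split=> [||a b c]; [exact: brA | exact: commutator_skew |].
apply: nest_at_lam_mu.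
rewrite [X in _ + X](subst2_nest_swap (x := (lam, a)) (y := (mu, b)) brA brA
  (\- partial \- lam \- mu, c) lamS muS).
exact: (nest_jacobi gA (nest_left_symmetric gA ls) (balanced_standard a b c)).
Qed.

Lemma prelie_comm_transposed f g : prelie_comm_conformal f g ->
  conformal_module_compat f g ->
  transposed_poisson_conformal f (conformal_commutator g).
Proof.
case=> fCA gLS lb cp; have [fA _ fC] := fCA; have [gA ls] := gLS.
have brA := commutator_conformal gA.
split=> [||a b c]; [exact: fCA | exact: commutator_lie |].
apply: nest_at_lam_mu.
have s2 p : subst2 lam mu (p *+ 2) = subst2 lam mu p *+ 2 :> formal A 2.
  by rewrite !mulr2n; exact: (subst2D lamS muS).
rewrite [LHS]s2.
rewrite [X in _ + X](subst2_nest_swap (x := (lam, a)) (y := (mu, b)) brA fA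
  (\- partial \- lam \- mu, c) lamS muS).
exact: (nest_transposed fA gA (comm_oppositeE fA fC) (nest_leibniz fA gA lb)
  (nest_compat cp) (balanced_standard a b c)).
Qed.

End Conclusion.

Theorem corollary4p12 (R : realType) (L : lmodType {poly R[i]})
    (circ ast : L -> L -> formal L 1) :
  (prelie_comm_conformal circ ast ->
   (forall a b c : L,
      (a%:MP *_[circ, lam] b%:MP) *_[ast, lam \+ mu] c%:MP
      = a%:MP *_[circ, lam] (b%:MP *_[ast, mu] c%:MP) :> formal L 2) ->
   transposed_poisson_conformal circ (conformal_commutator ast))
  /\
  (diff_novikov_poisson_conformal circ ast ->
   transposed_poisson_conformal circ (conformal_commutator ast)).
Proof.
split; first exact: prelie_comm_transposed.
case=> fCA [gLS _] cp _ lb.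
by apply: prelie_comm_transposed cp; split.
Qed.
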